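(* Let $\Sigma$ be a finite alphabet, $h:\Sigma^*\to M$ a monoid morphism into a finite monoid, and let $L\subseteq\Sigma^*$ be context-free and $h$-substitutable. Assume that the set $\mathcal P$ of relative primes of $(L,h)$ is finite. Then every live relative class is a context-free language over $\Sigma$, every correct-return language $\mathrm{Corr}_P$ ($P\in\mathcal P$) is a context-free language over the alphabet $\mathcal P$, and therefore $\mathrm{Corr}$ and $\mathrm{Pleon}$ are context-free languages over $\mathcal P$.
   Context: $D_L(x)=\{(u,v):uxv\in L\}$; $x\equiv_L y$ iff $D_L(x)=D_L(y)$. $L$ is $h$-substitutable if for all $x,y\in\Sigma^*$, $h(x)=h(y)$ and $D_L(x)\cap D_L(y)\ne\varnothing$ imply $x\equiv_L y$. The relative syntactic congruence $\theta$ is: $x\,\theta\,y$ iff $x\equiv_L y$ and $h(x)=h(y)$; its classes $[x]$ are called relative classes. A relative class is live if $D_L(x)\neq\varnothing$ for its members. The unit class is $[\varepsilon]$. For relative classes: $X\cdot Y=\{xy:x\in X,y\in Y\}$ and $X*Y=[xy]$ for any $x\in X,y\in Y$ (quotient product). A relative prime is a live relative class $P\neq[\varepsilon]$ such that whenever $P=X\cdot Y$ (equality of sets) for relative classes $X,Y$, one of $X,Y$ is $[\varepsilon]$. For $P\in\mathcal P$, $\mathrm{Corr}_P=\{P_1\cdots P_k\in\mathcal P^*:k\ge2,\ P_1*\cdots*P_k=P\}$; $\mathrm{Corr}=\bigcup_{P\in\mathcal P}\mathrm{Corr}_P$; and $\mathrm{Pleon}=\mathcal P^+\,\mathrm{Corr}\,\mathcal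 P^*\cup\mathcal P^*\,\mathrm{Corr}\,\mathcal P^+$ is the set of prime sequences having a proper contiguous block of length at least two whose quotient product is a relative prime. *)

(* Defs.v *)
From HB Require Import structures.
From Stdlib Require Import Relation_Operators.
From mathcomp Require Import all_boot.
From mathcomp Require Import boolp classical_sets functions cardinality.

Set Implicit Arguments.
Unset Strict Implicit.
Unset Printing Implicit Defensive.

Local Open Scope classical_set_scope.

#[short(type="finMonoidType")]
HB.structure Definition FinMonoid := {M of Monoid M & Finite M}.

(* The free monoid over T: the unit is [::] and the product is concatenation. *)
HB.instance Definition _ (T : choiceType) :=
  isMonoid.Build (seq T) (@catA T) (@cat0s T) (@cats0 T).

Definition language (T : Type) := set (seq T).

Definition lang_cat (T : Type) (A B : language T) : language T :=
  [set w | exists u v, [/\ A u, B v & w = u ++ v]].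

Record cfg (T : eqType) := Cfg {
  nonterminal : finType;
  start : nonterminal;
  rules : seq (nonterminal * seq (nonterminal + T))
}.

Definition cfg_step (T : eqType) (G : cfg T)
    (s t : seq (nonterminal G + T)) : Prop :=
  exists u v A r,
    [/\ (A, r) \in rules G, s = u ++ inl A :: v & t = u ++ r ++ v].

Definition cfg_language (T : eqType) (G : cfg T) : language T :=
  [set w | clos_refl_trans _ (@cfg_step T G) [:: inl (start G)] (map inr w)].

Definition context_free (T : eqType) (L : language T) : Prop :=
  exists G : cfg T, L = cfg_language G.

Definition contexts (Sigma : Type) (L : language Sigma) (x : seq Sigma) :
    set (seq Sigma * seq Sigma) :=
  [set c | L (c.1 ++ x ++ c.2)].

Definition syn_equiv (Sigma : Type) (L : language Sigma) (x y : seq Sigma) :=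
  contexts L x = contexts L y.

Definition substitutable (Sigma M : Type) (h : seq Sigma -> M)
    (L : language Sigma) : Prop :=
  forall x y, h x = h y -> contexts L x `&` contexts L y !=set0 ->
    syn_equiv L x y.

Definition rel_equiv (Sigma M : Type) (L : language Sigma) (h : seq Sigma -> M)
    (x y : seq Sigma) : Prop :=
  syn_equiv L x y /\ h x = h y.

Definition rel_class_of (Sigma M : Type) (L : language Sigma)
    (h : seq Sigma -> M) (x : seq Sigma) : language Sigma :=
  [set y | rel_equiv L h x y].

Definition rel_class (Sigma M : Type) (L : language Sigma) (h : seq Sigma -> M) :
    set (language Sigma) :=
  range (rel_class_of L h).

Definition live (Sigma : Type) (L X : language Sigma) : Prop :=
  forall x, X x -> contexts L x !=set0.

Definition unit_class (Sigma M : Type) (L : language Sigma)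
    (h : seq Sigma -> M) : language Sigma :=
  rel_class_of L h [::].

(* The union of the classes [xy] over x in X and y in Y; when X and Y are
   relative classes this is the single class [xy], see quot_prodE. *)
Definition quot_prod (Sigma M : Type) (L : language Sigma) (h : seq Sigma -> M)
    (X Y : language Sigma) : language Sigma :=
  [set z | exists x y, [/\ X x, Y y & rel_class_of L h (x ++ y) z]].

Lemma rel_equiv_cat (Sigma : choiceType) (M : monoidType) (L : language Sigma)
    (h : seq Sigma -> M) (hh : monoid_morphism h)
    (x x' y y' : seq Sigma) :
  rel_equiv L h x x' -> rel_equiv L h y y' ->
  rel_equiv L h (x ++ y) (x' ++ y').
Proof.
move=> [cx hx] [cy hy]; split; last first.
  by have := hh.2 x y; have := hh.2 x' y'; rewrite /= hx hy => <- <-.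
apply/seteqP; split=> -[u v]; rewrite /contexts /= -!catA => H.
- have : contexts L x (u, y ++ v) by [].
  rewrite cx /contexts /= => Hx.
  have : contexts L y (u ++ x', v) by rewrite /contexts /= -catA.
  by rewrite cy /contexts /= -catA.
- have : contexts L x' (u, y' ++ v) by [].
  rewrite -cx /contexts /= => Hx.
  have : contexts L y' (u ++ x, v) by rewrite /contexts /= -catA.
  by rewrite -cy /contexts /= -catA.
Qed.

Lemma quot_prodE (Sigma : choiceType) (M : monoidType) (L : language Sigma)
    (h : seq Sigma -> M) (hh : monoid_morphism h) (x y : seq Sigma) :
  quot_prod L h (rel_class_of L h x) (rel_class_of L h y) =
  rel_class_of L h (x ++ y).
Proof.
apply/seteqP; split=> z /=.
- move=> [x' [y' [Hx Hy [c e]]]].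
  have [c' e'] := rel_equiv_cat hh Hx Hy.
  by split; [exact: etrans c' c | exact: etrans e' e].
- by move=> Hz; exists x, y.
Qed.

(* For k >= 1 this is P_1 * ... * P_k, since the unit class is neutral. *)
Definition quot_prods (Sigma M : Type) (L : language Sigma)
    (h : seq Sigma -> M) (s : seq (language Sigma)) : language Sigma :=
  foldr (quot_prod L h) (unit_class L h) s.

Definition rel_prime (Sigma M : Type) (L : language Sigma)
    (h : seq Sigma -> M) : set (language Sigma) :=
  [set P | [/\ rel_class L h P, live L P, P <> unit_class L h &
     forall X Y, rel_class L h X -> rel_class L h Y -> P = lang_cat X Y ->
       X = unit_class L h \/ Y = unit_class L h]].

(* As an alphabet, rel_prime L h is coerced to the subtype of its elements. *)
Definition Corr_of (Sigma M : Type) (L : language Sigma) (h : seq Sigma -> M)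
    (P : rel_prime L h) : language (rel_prime L h) :=
  [set s | 2 <= size s /\ quot_prods L h (map val s) = val P].

Definition Corr (Sigma M : Type) (L : language Sigma) (h : seq Sigma -> M) :
    language (rel_prime L h) :=
  \bigcup_(P : rel_prime L h) Corr_of P.

Arguments Corr {Sigma M} L h _.

Definition lang_star (T : Type) : language T := setT.

Definition lang_plus (T : Type) : language T := [set w | w <> [::]].

Arguments lang_star {T} _.
Arguments lang_plus {T} _.

Definition Pleon (Sigma M : Type) (L : language Sigma) (h : seq Sigma -> M) :
    language (rel_prime L h) :=
  lang_cat (lang_cat lang_plus (Corr L h)) lang_star `|`
  lang_cat (lang_cat lang_star (Corr L h)) lang_plus.

Arguments Pleon {Sigma M} L h _.

(* Main.v *)
(* By substitutability, a live class [x] with uxv in L is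
   h^-1(h x) /\ u^-1 L v^-1, which is context-free. Choosing a word w_P in every
   prime P, the product of P_1, ..., P_k is the class of w_(P_1) ... w_(P_k);
   hence Corr_P is the preimage of the context-free language P under the
   morphism Q |-> w_Q, restricted to words of length at least two. This morphism
   is nonerasing because primes differ from the unit class. Quotients by words,
   intersections with regular languages and this preimage are all finite
   transductions. *)
Require Import Defs.
From Stdlib Require Import Relation_Operators.
From mathcomp Require Import all_boot.
From mathcomp Require Import boolp classical_sets functions cardinality.

Set Implicit Arguments.
Unset Strict Implicit.
Unset Printing Implicit Defensive.

Local Open Scope classical_set_scope.

(** * Context-free languages as least solutions of language inequations *)

Section LeastFixpoint.
Variable T : eqType.

Fixpoint sem (N : Type) (I : N -> language T) (s : seq (N + T)) : language T :=
  match s with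
  | [::] => [set [::]]
  | inl A :: s' => lang_cat (I A) (sem I s')
  | inr a :: s' => lang_cat [set [:: a]] (sem I s')
  end.

Definition rules_closed (N : eqType) (R : seq (N * seq (N + T)))
    (I : N -> language T) : Prop :=
  forall A r, (A, r) \in R -> sem I r `<=` I A.

(* Taking the intersection of all families closed under the rules, instead of
   derivation trees, makes [gen_sub] the induction principle and leaves only
   one proof ([cfg_languageE]) about derivation steps. *)
Definition gen (N : eqType) (R : seq (N * seq (N + T))) (A : N) : language T :=
  [set w | forall I, rules_closed R I -> I A w].

Lemma sem_sub (N : Type) (I J : N -> language T) (s : seq (N + T)) :
  (forall A, I A `<=` J A) -> sem I s `<=` sem J s.
Proof.
move=> IJ; elim: s => [|[A|a] s IHs] w //= [u [v [Iu /IHs Jv ->]]];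
  exists u, v; split=> //.
exact: IJ.
Qed.

Lemma sem_cat (N : Type) (I : N -> language T) (s t : seq (N + T)) :
  sem I (s ++ t) = lang_cat (sem I s) (sem I t).
Proof.
apply/seteqP; split.
  elim: s => [|[A|a] s IHs] w /=; first by exists [::], w.
    move=> [u [v [Iu /IHs[v1 [v2 [Iv1 Iv2 ->]]] ->]]].
    by exists (u ++ v1), v2; split; rewrite ?catA //; exists u, v1.
  move=> [u [v [Iu /IHs[v1 [v2 [Iv1 Iv2 ->]]] ->]]].
  by exists (u ++ v1), v2; split; rewrite ?catA //; exists u, v1.
elim: s => [|[A|a] s IHs] w /= [u [v [Iu Iv ->]]].
- by rewrite Iu.
- move: Iu => [u1 [u2 [Iu1 Iu2 ->]]]; exists u1, (u2 ++ v).
  by split; rewrite ?catA //; apply: IHs; exists u2, v.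
- move: Iu => [u1 [u2 [Iu1 Iu2 ->]]]; exists u1, (u2 ++ v).
  by split; rewrite ?catA //; apply: IHs; exists u2, v.
Qed.

Lemma sem_terminals (N : Type) (I : N -> language T) (w : seq T) :
  sem I (map inr w) = [set w].
Proof.
elim: w => [|a w IHw] //=; rewrite IHw; apply/seteqP; split=> z /=.
  by move=> [_ [_ [-> -> ->]]].
by move=> ->; exists [:: a], w.
Qed.

Lemma sem_inl1 (N : Type) (I : N -> language T) (A : N) :
  sem I [:: inl A] = I A.
Proof.
apply/seteqP; split=> w /=; last by exists w, [::]; rewrite cats0.
by move=> [u [_ [Iu -> ->]]]; rewrite cats0.
Qed.

(** [gen R] lies below every closed family, so monotonicity of [sem] passes membership on to each of
    them. *)
Lemma gen_closed (N : eqType) (R : seq (N * seq (N + T))) :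
  rules_closed R (gen R).
Proof.
move=> A r Ar w gw I clI; apply: (clI _ _ Ar).
by apply: sem_sub gw => B z; apply.
Qed.

Lemma gen_sub (N : eqType) (R : seq (N * seq (N + T))) (I : N -> language T) :
  rules_closed R I -> forall A, gen R A `<=` I A.
Proof. by move=> clI A w; apply. Qed.

Section Derivations.
Variable G : cfg T.
Local Notation derives := (clos_refl_trans _ (@cfg_step T G)).

Lemma derives_cat (u v s t : seq (nonterminal G + T)) :
  derives s t -> derives (u ++ s ++ v) (u ++ t ++ v).
Proof.
elim=> [x y [u' [v' [A [r [Ar -> ->]]]]]|x|x y z _ xy _ yz].
- apply: rt_step; exists (u ++ u'), (v' ++ v), A, r.
  by split=> //; rewrite -!catA.
- exact: rt_refl.
- exact: rt_trans xy yz.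
Qed.

(** The inclusion runs against the derivation: replacing a right-hand side by its nonterminal can
    only enlarge the interpretation, by [gen_closed]. *)
Lemma derives_sem (s t : seq (nonterminal G + T)) :
  derives s t -> sem (gen (rules G)) t `<=` sem (gen (rules G)) s.
Proof.
elim=> [x y [u [v [A [r [Ar -> ->]]]]] w|x w|x y z _ xy _ yz w /yz/xy] //.
rewrite (sem_cat _ u (r ++ v)) (sem_cat _ r) (sem_cat _ u).
move=> [w1 [_ [gw1 [w2 [w3 [gw2 gw3 ->]]] ->]]].
exists w1, (w2 ++ w3); split=> //; exists w2, w3; split=> //.
exact: gen_closed Ar _ gw2.
Qed.

Lemma cfg_languageE : cfg_language G = gen (rules G) (start G).
Proof.
apply/seteqP; split=> w /=.
  by move=> /derives_sem/(_ w); rewrite sem_terminals sem_inl1; apply.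
(* The terminal words derivable from each nonterminal form a closed family, so they contain the
   least one. *)
move: w; pose D A : language T := [set w | derives [:: inl A] (map inr w)].
apply: (@gen_sub _ _ D) => A r Ar z Dz; apply: rt_trans.
  by apply: rt_step; exists [::], [::], A, r; rewrite cats0.
elim: r z {Ar} Dz => [|[B|b] r IHr] z /=.
- by move=> ->; exact: rt_refl.
- move=> [u [v [Du /IHr Dv ->]]]; rewrite map_cat.
  apply: (@rt_trans _ _ _ ([:: inl B] ++ map inr v)).
    by have := derives_cat [:: inl B] [::] Dv; rewrite !cats0.
  exact: (@derives_cat [::] (map inr v) [:: inl B] (map inr u)).
- move=> [_ [v [-> /IHr Dv ->]]].
  by have := derives_cat [:: inr b] [::] Dv; rewrite !cats0.
Qed.

End Derivations.

Lemma context_freeP (K : language T) :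
  context_free K <->
  exists (N : finType) (R : seq (N * seq (N + T))) (S : N), K = gen R S.
Proof.
split=> [[G ->]|[N [R [S ->]]]].
  by exists (nonterminal G), (rules G), (start G); exact: cfg_languageE.
by exists (Cfg S R); rewrite cfg_languageE.
Qed.

End LeastFixpoint.

(** * Images of context-free languages under finite transducers *)

(* [step q a] lists the pairs (output word, next state) available on reading [a]
   in state [q]. *)
Section Transduction.
Variables (S T : eqType) (Q : finType) (step : Q -> S -> seq (seq T * Q)).

Fixpoint run (q : Q) (x : seq S) (w : seq T) (q' : Q) : Prop :=
  if x is a :: x' then
    exists o p w', [/\ (o, p) \in step q a, w = o ++ w' & run p x' w' q']
  else w = [::] /\ q = q'.

Lemma run_cat q x y w q' :
  run q (x ++ y) w q' <->
  exists p w1 w2, [/\ w = w1 ++ w2, run q x w1 p & run p y w2 q'].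
Proof.
elim: x q w => [|a x IHx] q w /=.
  split=> [rw|[p [w1 [w2 [-> [-> ->] //]]]]].
  by exists q, [::], w.
split=> [[o [p [w' [op -> /IHx[p' [w1 [w2 [-> r1 r2]]]]]]]]|].
  by exists p', (o ++ w1), w2; split; rewrite ?catA //; exists o, p, w1.
move=> [p' [_ [w2 [-> [o [p [w1 [op -> r1]]]] r2]]]].
exists o, p, (w1 ++ w2); rewrite catA; split=> //.
by apply/IHx; exists p', w1, w2.
Qed.

Section Grammar.
Variables (N : finType) (R : seq (N * seq (N + S))) (q0 : Q) (F : pred Q) (A0 : N).

Local Notation triple := (option (Q * N * Q)).

(** All ways to guess the intermediate states of a run along [r]: [Some (q, B, p)] stands for the
    outputs of runs from [q] to [p] on words of [B], and an input letter is replaced by the output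
    of a transition. *)
Fixpoint expand (r : seq (N + S)) (q q' : Q) : seq (seq (triple + T)) :=
  match r with
  | [::] => if q == q' then [:: [::]] else [::]
  | inl B :: r' =>
      [seq inl (Some (q, B, p)) :: z | p <- enum Q, z <- expand r' p q']
  | inr a :: r' =>
      [seq map inr e.1 ++ z | e <- step q a, z <- expand r' e.2 q']
  end.

Definition triple_rules : seq (triple * seq (triple + T)) :=
  [seq (None, [:: inl (Some (q0, A0, q))]) | q <- enum Q & F q] ++
  flatten [seq [seq (Some (pq.1, e.1, pq.2), z) | z <- expand e.2 pq.1 pq.2]
          | e <- R, pq <- enum {: Q * Q}].

Lemma triple_rulesP A z :
  (A, z) \in triple_rules <->
  (exists q, [/\ F q, A = None & z = [:: inl (Some (q0, A0, q))]]) \/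
  (exists B r q q',
    [/\ (B, r) \in R, A = Some (q, B, q') & z \in expand r q q']).
Proof.
rewrite mem_cat; split.
  case/orP=> [/mapP[q]|/flattenP[l /allpairsP[[[B r] [q q']]]]].
    by rewrite mem_filter => /andP[Fq _] [-> ->]; left; exists q.
  move=> /= [Br _ ->] /mapP[y yz [-> ->]].
  by right; exists B, r, q, q'.
case=> [[q [Fq -> ->]]|[B [r [q [q' [Br -> zr]]]]]]; apply/orP.
  by left; apply/mapP; exists q; rewrite // mem_filter Fq mem_enum.
right; apply/flattenP; exists [seq (Some (q, B, q'), y) | y <- expand r q q'].
  by apply/allpairsP; exists ((B, r), (q, q')); rewrite mem_enum.
exact: map_f.
Qed.

(** The intended meaning of each nonterminal, used as the closed family that bounds
    [gen triple_rules] from above. *)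
Definition image_sem (A : triple) : language T :=
  if A is Some (q, B, q') then [set w | exists2 x, gen R B x & run q x w q']
  else [set w | exists x q, [/\ gen R A0 x, F q & run q0 x w q]].

Lemma sem_expand r q q' z w : z \in expand r q q' -> sem image_sem z w ->
  exists2 x, sem (gen R) r x & run q x w q'.
Proof.
elim: r q z w => [|[B|a] r IHr] q z w /=.
- by case: eqP => // ->; rewrite inE => /eqP -> /= ->; exists [::].
- move=> /allpairsPdep[p [y [_ yr ->]]] /= [w1 [w2 [[x1 gx1 r1] sw2 ->]]].
  have [x2 sx2 r2] := IHr _ _ _ yr sw2.
  exists (x1 ++ x2); first by exists x1, x2.
  by apply/run_cat; exists p, w1, w2.
- move=> /allpairsPdep[[o p] [y [/= op yr ->]]].
  rewrite sem_cat sem_terminals => -[_ [w2 [-> sw2 ->]]].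
  have [x2 sx2 r2] := IHr _ _ _ yr sw2.
  by exists (a :: x2); [exists [:: a], x2 | exists o, p, w2].
Qed.

(** The family inside [sem] collects the words all of whose runs are already generated; with
    [gen_closed], this lemma makes it closed under the source rules [R]. *)
Lemma expand_run s x q q' w :
  sem (fun B => [set x | forall q q' w, run q x w q' ->
                   gen triple_rules (Some (q, B, q')) w]) s x ->
  run q x w q' ->
  exists2 z, z \in expand s q q' & sem (gen triple_rules) z w.
Proof.
elim: s x q w => [|[B|a] s IHs] x q w /=.
- by move=> -> /= [-> ->]; exists [::]; rewrite ?eqxx ?inE.
- move=> [x1 [x2 [gx1 sx2 ->]]] /run_cat[p [w1 [w2 [-> r1 r2]]]].
  have [z zs gz] := IHs _ _ _ sx2 r2.
  exists (inl (Some (q, B, p)) :: z); last by exists w1, w2; split=> //; exact: gx1.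
  by apply/allpairsPdep; exists p, z; rewrite mem_enum.
- move=> [_ [x2 [-> sx2 ->]]] /= [o [p [w2 [op -> r2]]]].
  have [z zs gz] := IHs _ _ _ sx2 r2.
  exists (map inr o ++ z).
    by apply/allpairsPdep; exists (o, p), z.
  by rewrite sem_cat sem_terminals; exists o, w2.
Qed.

Lemma gen_triple_rules :
  gen triple_rules None =
  [set w | exists x q, [/\ gen R A0 x, F q & run q0 x w q]].
Proof.
apply/seteqP; split.
  apply: (@gen_sub _ _ _ image_sem) => A z /triple_rulesP[].
    move=> [q [Fq -> ->]] w; rewrite sem_inl1 => -[x gx rx].
    by exists x, q.
  move=> [B [r [q [q' [Br -> zr]]]]] w /(sem_expand zr)[x sx rx].
  by exists x => //; exact: gen_closed Br _ sx.
move=> w [x [q [gx Fq rx]]].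
apply: (@gen_closed _ _ _ None [:: inl (Some (q0, A0, q))]).
  by apply/triple_rulesP; left; exists q.
rewrite sem_inl1.
(* The induction ranges over all pairs of states, since the runs on subwords start and end in
   arbitrary states. *)
suff: forall B, gen R B `<=` [set x | forall q q' w, run q x w q' ->
    gen triple_rules (Some (q, B, q')) w] by move=> /(_ A0 x gx); apply.
apply: gen_sub => B r Br y sy p p' v rv.
have [z zr gz] := expand_run sy rv.
apply: gen_closed gz.
by apply/triple_rulesP; right; exists B, r, p, p'.
Qed.

End Grammar.

(* Bar-Hillel triple construction. *)
Lemma context_free_transduction (K : language S) (q0 : Q) (F : pred Q) :
  context_free K ->
  context_free [set w | exists x q, [/\ K x, F q & run q0 x w q]].
Proof.
move=> /context_freeP[N [R [A0 ->]]]; apply/context_freeP.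
by exists (option (Q * N * Q)), (triple_rules R q0 F A0), None;
  rewrite gen_triple_rules.
Qed.

End Transduction.

(** * Closure properties of context-free languages *)

Section Closure.
Variable T : eqType.
Implicit Types K J : language T.

(** The transducer copies its input while its state follows the automaton [delta]. *)
Lemma context_free_regular (Q : finType) (delta : Q -> T -> Q) (q0 : Q)
    (F : pred Q) K :
  context_free K -> context_free [set w | K w /\ F (foldl delta q0 w)].
Proof.
move=> cfK; pose step q a := [:: ([:: a], delta q a)].
have runE q x w q' : run step q x w q' <-> w = x /\ q' = foldl delta q x.
  elim: x q w q' => [|a x IHx] q w q' /=; first by split=> -[-> ->].
  split=> [[o [p [w' []]]]|[-> ->]].
    by rewrite inE => /eqP[-> ->] -> /IHx[-> ->].
  exists [:: a], (delta q a), x; rewrite inE eqxx; split=> //.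
  exact/IHx.
have := context_free_transduction step q0 F cfK.
congr context_free; apply/seteqP; split=> w /=.
  by move=> [x [q [Kx Fq /runE[-> eq]]]]; rewrite -eq.
by move=> [Kw Fw]; exists w, (foldl delta q0 w); split=> //; exact/runE.
Qed.

(** The transducer erases the first letter, which must be [a], and then copies; its state tells
    whether the erasure has happened. *)
Lemma context_free_lquot1 (a : T) K :
  context_free K -> context_free [set w | K (a :: w)].
Proof.
move=> cfK; pose step (q : bool) b : seq (seq T * bool) :=
  if q then [:: ([:: b], true)] else if b == a then [:: ([::], true)] else [::].
have run1 x w : run step true x w true <-> w = x.
  elim: x w => [|b x IHx] w /=; first by split=> [[]|->].
  split=> [[o [p [w' []]]]|->].
    by rewrite inE => /eqP[-> ->] -> /IHx ->.
  by exists [:: b], true, x; rewrite inE eqxx; split=> //; exact/IHx.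
have := context_free_transduction step false id cfK.
congr context_free; apply/seteqP; split=> w /=.
  move=> [[|b x] [[] [Kx // _]]] /=; first by case.
  case=> o [p [w' []]]; case: eqP => // ba; rewrite inE => /eqP[-> ->] -> /run1.
  by move=> ->; rewrite -ba.
move=> Kw; exists (a :: w), true; split=> //=.
by exists [::], true, w; rewrite eqxx inE; split=> //; exact/run1.
Qed.

(** Here the transducer guesses which [a] is the last letter and erases it. State [true] has no
    transitions, so a wrong guess blocks. *)
Lemma context_free_rquot1 (a : T) K :
  context_free K -> context_free [set w | K (rcons w a)].
Proof.
move=> cfK; pose step (q : bool) b : seq (seq T * bool) :=
  if q then [::]
  else ([:: b], false) :: if b == a then [:: ([::], true)] else [::].
have runE x w : run step false x w true <-> x = rcons w a.
  elim: x w => [|b x IHx] w /=; first by split=> [[]|]; case: w.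
  split=> [[o [p [w' [ + -> {w}]]]]|].
    rewrite inE => /orP[/eqP[-> ->] /IHx -> //|].
    case: eqP => // ->; rewrite inE => /eqP[-> ->] /=.
    by case: x {IHx} => [[-> _]|c x [o' [p' [w2 []]]]].
  case: w => [[-> ->]|c w [-> xE]].
    by exists [::], true, [::]; rewrite eqxx !inE eqxx orbT.
  by exists [:: c], false, w; rewrite inE eqxx; split=> //; exact/IHx.
have := context_free_transduction step false id cfK.
congr context_free; apply/seteqP; split=> w /=.
  by move=> [x [[] [Kx // _ /runE <-]]].
by move=> Kw; exists (rcons w a), true; split=> //; exact/runE.
Qed.

Lemma context_free_quot (u v : seq T) K :
  context_free K -> context_free [set w | K (u ++ w ++ v)].
Proof.
elim: u K => [|a u IHu] K cfK; last first.
  exact: (IHu [set w | K (a :: w)]) (context_free_lquot1 a cfK).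
elim/last_ind: v K cfK => [|v b IHv] K cfK.
  by move: cfK; congr context_free; apply/seteqP; split=> w /=; rewrite cats0.
have := IHv [set w | K (rcons w b)] (context_free_rquot1 b cfK).
by congr context_free; apply/seteqP; split=> w /=; rewrite rcons_cat.
Qed.

Lemma context_free0 : context_free (set0 : language T).
Proof.
apply/context_freeP; exists unit, [::], tt.
by apply/seteqP; split=> w //; apply: (@gen_sub _ _ _ (fun=> set0)).
Qed.

(** An exhaustive list [e] expresses finiteness of the alphabet, because the primes will be known to
    be finite only by hypothesis. *)
Lemma context_freeT (e : seq T) :
  (forall t, t \in e) -> context_free (setT : language T).
Proof.
move=> eT; apply/context_freeP.
pose R : seq (unit * seq (unit + T)) :=
  (tt, [::]) :: [seq (tt, [:: inr t; inl tt]) | t <- e].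
exists unit, R, tt; apply/seteqP; split=> // w _.
elim: w => [|t w IHw]; first by apply: (@gen_closed _ _ _ tt [::]).
apply: (@gen_closed _ _ _ tt [:: inr t; inl tt]).
  by rewrite inE; apply/orP; right; apply/mapP; exists t.
by exists [:: t], w; split=> //; rewrite sem_inl1.
Qed.

Section Join.
Variables (N N' : finType) (R : seq (N * seq (N + T))).
Variables (R' : seq (N' * seq (N' + T))) (tops : seq (seq (N + N'))).

Definition relabel (M M' : Type) (f : M -> M') (s : seq (M + T)) :
    seq (M' + T) :=
  [seq match x with inl A => inl (f A) | inr a => inr a end | x <- s].

Lemma sem_relabel (M M' : Type) (f : M -> M') (I : M' -> language T) s :
  sem I (relabel f s) = sem (I \o f) s.
Proof. by elim: s => [|[A|a] s IHs] //=; rewrite IHs. Qed.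

(** Two grammars side by side under a fresh start symbol [None] with right-hand sides [tops]. Union
    and concatenation differ only in [tops]: two words of length one, or one word of length two. *)
Definition join_rules :
    seq (option (N + N') * seq (option (N + N') + T)) :=
  [seq (None, map (inl \o some) s) | s <- tops] ++
  [seq (Some (inl e.1), relabel (some \o inl) e.2) | e <- R] ++
  [seq (Some (inr e.1), relabel (some \o inr) e.2) | e <- R'].

Definition join_sem (A : N + N') : language T :=
  match A with inl B => gen R B | inr B => gen R' B end.

Lemma gen_join_rules :
  gen join_rules None =
  [set w | exists2 s, s \in tops & sem join_sem (map inl s) w].
Proof.
apply/seteqP; split.
  pose I (A : option (N + N')) := if A is Some B then join_sem B else
    [set w | exists2 s, s \in tops & sem join_sem (map inl s) w].
  apply: (@gen_sub _ _ _ I) => A r; rewrite !mem_cat.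
  case/or3P=> /mapP[].
  - move=> s sT [-> ->] w sw; exists s => //.
    by elim: s w sw {sT} => [|B s IHs] //= w [u [v [Iu /IHs sv ->]]]; exists u, v.
  - by move=> [B s] Bs [-> ->] w; rewrite sem_relabel; exact: gen_closed.
  - by move=> [B s] Bs [-> ->] w; rewrite sem_relabel; exact: gen_closed.
(* The joint least family, pulled back along either injection, is closed under the rules of that
   component. *)
have subJ A : join_sem A `<=` gen join_rules (Some A).
  case: A => A /=.
    apply: (@gen_sub _ _ _ (fun A => gen join_rules (Some (inl A)))) => B r Br w.
    rewrite -(sem_relabel (some \o inl) (gen join_rules)).
    apply: gen_closed; rewrite !mem_cat; apply/or3P; apply: Or32.
    by apply/mapP; exists (B, r).
  apply: (@gen_sub _ _ _ (fun A => gen join_rules (Some (inr A)))) => B r Br w.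
  rewrite -(sem_relabel (some \o inr) (gen join_rules)).
  apply: gen_closed; rewrite !mem_cat; apply/or3P; apply: Or33.
  by apply/mapP; exists (B, r).
move=> w [s sT sw]; apply: (@gen_closed _ _ _ None (map (inl \o some) s)).
  by rewrite mem_cat map_f.
elim: s w sw {sT} => [|B s IHs] //= w [u [v [/subJ Iu /IHs sv ->]]].
by exists u, v.
Qed.

End Join.

Lemma context_free_setU K J :
  context_free K -> context_free J -> context_free (K `|` J).
Proof.
move=> /context_freeP[N [R [A ->]]] /context_freeP[N' [R' [A' ->]]].
apply/context_freeP; exists (option (N + N')),
  (join_rules R R' [:: [:: inl A]; [:: inr A']]), None.
rewrite gen_join_rules; apply/seteqP; split=> w /=.
  case=> gw; [exists [:: inl A]|exists [:: inr A']];
    by rewrite ?inE ?eqxx ?orbT //= (sem_inl1 _ (_ A)) || rewrite sem_inl1.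
by move=> [s]; rewrite !inE => /orP[]/eqP ->; rewrite sem_inl1; [left|right].
Qed.

Lemma context_free_cat K J :
  context_free K -> context_free J -> context_free (lang_cat K J).
Proof.
move=> /context_freeP[N [R [A ->]]] /context_freeP[N' [R' [A' ->]]].
apply/context_freeP; exists (option (N + N')),
  (join_rules R R' [:: [:: inl A; inr A']]), None.
rewrite gen_join_rules; apply/seteqP; split=> w /=.
  move=> [u [v [gu gv ->]]]; exists [:: inl A; inr A']; rewrite ?inE //.
  by exists u, v; split=> //; rewrite sem_inl1.
move=> [s]; rewrite inE => /eqP -> [u [_ [gu [v [_ [gv -> ->]]] ->]]].
by exists u, v; rewrite cats0.
Qed.

Lemma context_free_bigcup (I : eqType) (e : seq I) (K : I -> language T) :
  (forall i, i \in e) -> (forall i, context_free (K i)) ->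
  context_free (\bigcup_i K i).
Proof.
move=> eI cfK.
(* Relativizing the union to [e] permits induction on the list. *)
suff: context_free [set w | exists2 i, i \in e & K i w].
  congr context_free; apply/seteqP; split=> w [i _ Kw]; by exists i.
elim: e {eI} => [|i e IHe].
  by have := context_free0; congr context_free; apply/seteqP; split=> w // [].
have := context_free_setU (cfK i) IHe.
congr context_free; apply/seteqP; split=> w /=.
  case=> [Kw|[j je Kw]]; [exists i|exists j] => //.
    by rewrite inE eqxx.
  by rewrite inE je orbT.
by move=> [j]; rewrite inE => /orP[/eqP ->|je] Kw; [left|right; exists j].
Qed.

End Closure.

(* The transducer remembers the part of the current block [phi t] that is still
   to be read, and outputs [t] on reading the first letter of the block; this is
   where [phi] has to be nonerasing. *)
Lemma context_free_preimage (S : finType) (T : eqType) (e : seq T)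
    (phi : T -> seq S) (K : language S) :
  (forall t, t \in e) -> (forall t, phi t <> [::]) -> context_free K ->
  context_free [set s | K (flatten (map phi s))].
Proof.
(* Since [n] bounds all blocks, it bounds every unread remainder, and [n.-bseq S] is a finite state
   set. *)
move=> eT phiN cfK; pose n := \max_(t <- e) size (phi t).
have size_phi t : size (phi t) <= n by exact: leq_bigmax_seq.
pose step (q : n.-bseq S) a : seq (seq T * n.-bseq S) :=
  if bseqval q is b :: z then
    if a == b then [:: ([::], insub_bseq n z)] else [::]
  else [seq ([:: t], insub_bseq n (behead (phi t)))
       | t <- e & ohead (phi t) == Some a].
(* Beyond length [n], [insub_bseq] returns a default value, hence the length checks below. *)
have insubE (z : seq S) : size z <= n -> bseqval (insub_bseq n z) = z.
  by move=> zn; rewrite /insub_bseq val_insubd zn.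
(* Stated for any pending remainder [q] so that induction on the input applies; only the empty one
   is used in the end. *)
have runE x q w : run step q x w [bseq] <-> x = bseqval q ++ flatten (map phi w).
  elim: x q w => [|a x IHx] q w /=.
    split=> [[-> ->] //|].
    case: w => [|t w] /=; first by rewrite cats0 => qE; split=> //; exact/val_inj.
    case phit: (phi t) => [|b z]; first by case: (phiN t).
    by case: (bseqval q).
  split=> [[o [p [w' []]]]|].
    rewrite /step; case qE: (bseqval q) => [|b z].
      move=> /mapP[t]; rewrite mem_filter => /andP[/eqP ht _] [-> ->] -> /IHx ->.
      rewrite insubE; last by rewrite size_behead (leq_trans (leq_pred _)).
      by rewrite /=; case: (phi t) ht => //= c z [->].
    case: eqP => // -> ; rewrite inE => /eqP[-> ->] -> /IHx ->.
    rewrite insubE //; apply: leq_trans (size_bseq q).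
    by rewrite [X in _ <= size X]qE.
  case qE: (bseqval q) => [|b z] /=.
    case: w => [//|t w] /=.
    case phit: (phi t) => [|c z]; first by case: (phiN t).
    move=> [-> xE]; exists [:: t], (insub_bseq n z), w.
    have zn : size z <= n.
      by apply: ltnW; have := size_phi t; rewrite phit.
    split=> //; last by apply/IHx; rewrite insubE.
    rewrite /step qE; apply/mapP; exists t; rewrite ?phit //.
    by rewrite mem_filter eT phit eqxx.
  move=> [-> xE]; exists [::], (insub_bseq n z), w.
  have zn : size z <= n.
    by apply: ltnW; have := size_bseq q; rewrite [X in size X <= _]qE.
  split=> //; last by apply/IHx; rewrite insubE.
  by rewrite /step qE eqxx inE.
have := context_free_transduction step [bseq] (pred1 [bseq]) cfK.
congr context_free; apply/seteqP; split=> w /=.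
  by move=> [x [q [Kx /eqP -> /runE xE]]]; rewrite xE in Kx.
by move=> Kw; exists (flatten (map phi w)), [bseq]; split=> //=; exact/runE.
Qed.

(** * Relative classes, and correct returns as preimages of primes *)

Section RelativeClasses.
Variables (Sigma : finType) (M : finMonoidType) (h : seq Sigma -> M).
Hypothesis h_morph : monoid_morphism h.
Variable L : language Sigma.
Local Notation cls := (rel_class_of L h).

Lemma mem_rel_class_of x : cls x x.
Proof. by []. Qed.

Lemma eq_rel_class_of x y : (cls x = cls y) <-> cls x y.
Proof.
split=> [->|[c e]]; first exact: mem_rel_class_of.
by apply/seteqP; split=> z [c' e']; split; rewrite /syn_equiv -?c' -?e' ?c ?e.
Qed.

(** The single shared context [(u, v)], together with equal values under [h], already forces
    syntactic equivalence. *)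
Lemma rel_class_of_context x u v :
  substitutable h L -> L (u ++ x ++ v) ->
  cls x = [set y | L (u ++ y ++ v) /\ h y = h x].
Proof.
move=> subL Lx; apply/seteqP; split=> y /=.
  move=> [c e]; split=> //.
  by have : contexts L x (u, v) by []; rewrite c.
by move=> [Ly e]; split=> //; apply: subL => //; exists (u, v).
Qed.

(** The monoid [M], acting on itself by right multiplication, is a finite automaton recognizing the
    fibres of [h]. *)
Lemma foldl_morphism s :
  foldl (fun m a => (m * h [:: a])%g) 1%g s = h s.
Proof.
suff: forall m, foldl (fun m a => (m * h [:: a])%g) m s = (m * h s)%g.
  by move=> ->; rewrite mul1g.
elim: s => [|a s IHs] m /=; first by rewrite h_morph.1 mulg1.
by rewrite IHs -mulgA -(h_morph.2 [:: a] s).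
Qed.

Lemma context_free_live_class X : context_free L -> substitutable h L ->
  rel_class L h X -> live L X -> context_free X.
Proof.
move=> cfL subL [x _ <-] /(_ x (mem_rel_class_of x))[[u v] Lx].
rewrite (rel_class_of_context subL Lx).
have := context_free_regular (fun m a => (m * h [:: a])%g) 1%g (pred1 (h x))
  (context_free_quot u v cfL).
congr context_free; apply/seteqP; split=> y /=; rewrite foldl_morphism.
  by move=> [Ly /eqP].
by move=> [Ly ->].
Qed.

(** The default of [xget] is never taken, as every prime is the class of some word. *)
Definition class_repr (P : rel_prime L h) : seq Sigma :=
  xget [::] [set x | cls x = val P].

Lemma class_reprE (P : rel_prime L h) : cls (class_repr P) = val P.
Proof.
have [[x _ xP] _ _ _] := set_valP P.
exact: (xgetI [::] (xP : [set x | cls x = val P] x)).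
Qed.

Lemma class_repr_neq0 (P : rel_prime L h) : class_repr P <> [::].
Proof.
have [_ _ PN _] := set_valP P.
by move=> P0; apply: PN; have := class_reprE P; rewrite P0.
Qed.

Lemma quot_prods_repr (s : seq (rel_prime L h)) :
  quot_prods L h (map val s) = cls (flatten (map class_repr s)).
Proof.
elim: s => [//|P s IHs] /=.
by rewrite -/(quot_prods _ _ _) IHs -quot_prodE // class_reprE.
Qed.

(** A class equals [P] exactly when its representative lies in [P], so an equation between classes
    becomes membership. *)
Lemma Corr_of_repr (P : rel_prime L h) :
  Corr_of P = [set s | (val P) (flatten (map class_repr s)) /\ 2 <= size s].
Proof.
apply/seteqP; split=> s; rewrite /Corr_of /= quot_prods_repr -class_reprE.
  by move=> [? /esym/eq_rel_class_of].
by move=> [/eq_rel_class_of <-].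
Qed.

Lemma context_free_Corr_of (e : seq (rel_prime L h)) (P : rel_prime L h) :
  (forall Q, Q \in e) -> context_free (val P) -> context_free (Corr_of P).
Proof.
move=> eT cfP; rewrite Corr_of_repr.
(* The two bits record whether at least one and at least two letters have been read; [(true, true)]
   is absorbing. *)
have := context_free_regular (fun (b : bool * bool) _ => (true, b.1))
  (false, false) snd (context_free_preimage eT class_repr_neq0 cfP).
have stable (s : seq (rel_prime L h)) :
  foldl (fun (b : bool * bool) _ => (true, b.1)) (true, true) s = (true, true).
  by elim: s.
by congr context_free; apply/seteqP; split=> -[|p [|p' s]] //=; rewrite ?stable.
Qed.

End RelativeClasses.

(** * Assembly over the finite alphabet of primes *)

Lemma context_free_lang_plus (T : eqType) (e : seq T) :
  (forall t, t \in e) -> context_free (@lang_plus T).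
Proof.
move=> /context_freeT.
move=> /(context_free_regular (fun _ _ => true) false id).
have stable (s : seq T) : foldl (fun _ _ => true) true s by elim: s.
by congr context_free; apply/seteqP; split=> -[|t s] //=; rewrite ?stable // => -[].
Qed.

Lemma finite_set_type_enum (T : choiceType) (A : set T) :
  finite_set A -> exists e : seq A, forall x, x \in e.
Proof.
move=> /finite_seqP[s As]; exists (pmap insub s) => x.
by rewrite mem_pmap_sub; have := set_valP x; rewrite {1}As.
Qed.

Theorem proposition10p3 (Sigma : finType) (M : finMonoidType)
    (h : seq Sigma -> M) (h_morph : monoid_morphism h)
    (L : language Sigma) (L_cf : context_free L)
    (L_subst : substitutable h L)
    (primes_fin : finite_set (rel_prime L h)) :
  (forall X : language Sigma, rel_class L h X -> live L X -> context_free X) /\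
  (forall P : rel_prime L h, context_free (Corr_of P)) /\
  context_free (Corr L h) /\
  context_free (Pleon L h).
Proof.
have [e eP] := finite_set_type_enum primes_fin.
have cf_class X := @context_free_live_class _ _ _ h_morph L X L_cf L_subst.
have cf_Corr_of (P : rel_prime L h) : context_free (Corr_of P).
  apply: context_free_Corr_of eP _ => //.
  (* A prime is itself a live relative class, so the first claim applies to it. *)
  by have [Pcls Plive _ _] := set_valP P; exact: cf_class.
have cf_Corr : context_free (Corr L h) by exact: context_free_bigcup eP _.
split=> //; split=> //; split=> //.
have cf_star : context_free (@lang_star (rel_prime L h)) := context_freeT eP.
have cf_plus := context_free_lang_plus eP.
by apply: context_free_setU; do !apply: context_free_cat.
Qed.
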